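(* Let $H$ be a connected graph or the union of a connected graph and an isolated vertex, with $|V(H)|\ge 3$, and let $G$ be a connected $(P_5, K_1+H)$-free graph. If $(P_5,H)$-free graphs have a $\chi$-binding function $f(\omega)$, then $$\chi(G)\le \max\{\chi(H), f(\omega(G)-1)\}+|V(H)|\, f(\omega(G)-1),$$ and in particular, $\chi(G)\le (|V(H)|+1)\, f(\omega(G)-1)$ when $\chi(H)$ is sufficiently small.
   Context: All graphs are finite and simple. $\chi(G)$ is the chromatic number and $\omega(G)$ the clique number of $G$. $P_k$ is the path on $k$ vertices and $K_1$ is the one-vertex graph. The union of two vertex-disjoint graphs has as vertex set the union of their vertex sets and as edge set the union of their edge sets. The join $G_1+G_2$ of two vertex-disjoint graphs is obtained from their union by adding all edges between $V(G_1)$ and $V(G_2)$; thus $K_1+H$ is $H$ together with one new vertex adjacent to all vertices of $H$. A graph is $F$-free if it has no induced subgraph isomorphic to $F$, and $(F_1,F_2)$-free if it is both $F_1$-free and $F_2$-free. A function $f$ is a $\chi$-binding function for a class $\mathcal{G}$ of graphs if $\chi(G')\le f(\omega(G'))$ for every $G'\in\mathcal{G}$. *)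

(* Defs.v *)
From HB Require Import structures.
From mathcomp Require Import all_boot all_order all_algebra.

Set Implicit Arguments.
Unset Strict Implicit.
Unset Printing Implicit Defensive.

Import Order.TTheory GRing.Theory Num.Theory.

Record sgraph := SGraph {
  vertex :> finType;
  adj : rel vertex;
  adj_sym : symmetric adj;
  adj_irrefl : irreflexive adj
}.

Arguments adj {s} x y.

Definition isomorphic (F G : sgraph) : Prop :=
  exists2 h : F -> G, bijective h & {mono h : x y / adj x y}.

Section Induced.
Variables (G : sgraph) (S : {set G}).

Definition induced_adj : rel {x : G | x \in S} :=
  fun x y => adj (val x) (val y).

Lemma induced_adj_sym : symmetric induced_adj.
Proof. by move=> x y; apply: adj_sym. Qed.

Lemma induced_adj_irrefl : irreflexive induced_adj.
Proof. by move=> x; apply: adj_irrefl. Qed.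

Definition induced : sgraph := SGraph induced_adj_sym induced_adj_irrefl.

End Induced.

Definition free_of (F G : sgraph) : Prop :=
  forall S : {set G}, ~ isomorphic (induced S) F.

Definition free_of2 (F1 F2 G : sgraph) : Prop := free_of F1 G /\ free_of F2 G.

(* The graph with no vertex is not connected. *)
Definition connected (G : sgraph) : Prop :=
  (0 < #|G|)%N /\ forall x y : G, connect adj x y.

Section PathGraph.
Variable k : nat.

Definition path_adj : rel 'I_k :=
  fun i j => (i.+1 == j :> nat) || (j.+1 == i :> nat).

Lemma path_adj_sym : symmetric path_adj.
Proof. by move=> i j; rewrite /path_adj orbC. Qed.

Lemma path_adj_irrefl : irreflexive path_adj.
Proof. by move=> i; rewrite /path_adj orbb gtn_eqF. Qed.

(* P_k, on k vertices (hence k - 1 edges). *)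
Definition path_graph : sgraph := SGraph path_adj_sym path_adj_irrefl.

End PathGraph.

Section CompleteGraph.
Variable k : nat.

Definition complete_adj : rel 'I_k := fun i j => i != j.

Lemma complete_adj_sym : symmetric complete_adj.
Proof. by move=> i j; rewrite /complete_adj eq_sym. Qed.

Lemma complete_adj_irrefl : irreflexive complete_adj.
Proof. by move=> i; rewrite /complete_adj eqxx. Qed.

Definition complete_graph : sgraph :=
  SGraph complete_adj_sym complete_adj_irrefl.

End CompleteGraph.

Section UnionJoin.
Variables G1 G2 : sgraph.

(* [cross] is the common value of all the adjacencies between the two sides:
   [false] for the disjoint union, [true] for the join. *)
Definition sum_adj (cross : bool) : rel (G1 + G2)%type :=
  fun u v => match u, v with
  | inl x, inl y => adj x y
  | inr x, inr y => adj x y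
  | _, _ => cross
  end.

Lemma sum_adj_sym cross : symmetric (sum_adj cross).
Proof. by move=> [x|x] [y|y] //=; apply: adj_sym. Qed.

Lemma sum_adj_irrefl cross : irreflexive (sum_adj cross).
Proof. by move=> [x|x] /=; apply: adj_irrefl. Qed.

Definition union_graph : sgraph :=
  SGraph (sum_adj_sym false) (sum_adj_irrefl false).

Definition join_graph : sgraph :=
  SGraph (sum_adj_sym true) (sum_adj_irrefl true).

End UnionJoin.

Definition colorable (G : sgraph) (k : nat) : bool :=
  [exists c : {ffun G -> 'I_k}, forall x, forall y, adj x y ==> (c x != c y)].

Lemma colorable_card (G : sgraph) : exists k, colorable G k.
Proof.
exists #|G|; apply/existsP; exists [ffun x => enum_rank x].
apply/forallP=> x; apply/forallP=> y; apply/implyP=> xy; rewrite !ffunE.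
by apply: contraTneq xy => /enum_rank_inj->; rewrite adj_irrefl.
Qed.

Definition chi (G : sgraph) : nat := ex_minn (colorable_card G).

Definition clique (G : sgraph) (S : {set G}) : bool :=
  [forall x in S, forall y in S, (x != y) ==> adj x y].

Definition omega (G : sgraph) : nat := \max_(S : {set G} | clique S) #|S|.

(* Binding functions occurring in practice need not be integer-valued, so the
   values are taken in an arbitrary ordered field. *)
Definition chi_binding (R : realFieldType) (C : sgraph -> Prop)
    (f : nat -> R) : Prop :=
  forall G : sgraph, C G -> ((chi G)%:R <= f (omega G))%R.

(* Main.v *)
Require Import Defs.
From mathcomp Require Import all_boot all_order all_algebra.

Set Implicit Arguments.
Unset Strict Implicit.
Unset Printing Implicit Defensive.

Import Order.TTheory GRing.Theory Num.Theory.

(** The argument is a Gyarfas path of length two, which needs no copy of H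
in G. Let G be connected and P_5-free, with every neighbourhood N(v) colourable
by c colours. Fix v and a component A of what remains when v and N(v) are
deleted. As G is connected, some x in N(v) has a neighbour in A. Colour N(v),
v itself, and the part of A in N(x) with c, 1 and c colours. For a component B
of the rest of A, the connectedness of A gives a vertex a of A in N(x) with a
neighbour in B; if a missed some vertex of B, there would be an edge b b' of B
with b adjacent to a and b' not, and v, x, a, b, b' would induce P_5. So B lies
in N(a) and c further colours suffice. Distinct components share their colours,
hence chi(G) <= 3c + 1 ([chi_gyarfas]). Since |H| >= 3 and chi(H) >= 1, this is
at most chi(H) + |H| c.

It remains to see that c can be taken at most f(omega(G) - 1)
([chi_binding_nbh]). Each N(v) induces a (P_5, H)-free graph of clique number
at most omega(G) - 1, but f need not be monotone, so N(v) is first enlarged to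
a (P_5, H)-free graph of clique number exactly omega(G) - 1. If H is connected,
take the disjoint union with N(w) for some w in a maximum clique; if H has an
isolated vertex, hence no vertex adjacent to all others, take the join with a
complete graph of the missing size. P_5 is preserved both times, being
connected and having no vertex adjacent to all others. *)

(** * Induced subgraphs as embeddings *)

(** Freeness is handled through embeddings rather than through vertex sets, so
that it can be transported along maps between different graphs. *)
Definition embeds (F G : sgraph) : Prop :=
  exists2 h : F -> G, injective h & {mono h : x y / adj x y}.

Lemma embeds_trans (F G K : sgraph) : embeds F G -> embeds G K -> embeds F K.
Proof.
move=> [h h_inj h_mono] [g g_inj g_mono]; exists (g \o h).
  exact: inj_comp.
by move=> x y /=; rewrite g_mono h_mono.
Qed.

(** A copy of F in K that lives inside a piece G of K is a copy of F in G. *)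
Lemma embeds_factor (F G K : sgraph) (h : F -> K) (i : G -> K) :
  injective h -> {mono h : x y / adj x y} -> {mono i : x y / adj x y} ->
  (forall x, exists y, h x = i y) -> embeds F G.
Proof.
move=> h_inj h_mono i_mono /fin_all_exists[g hE]; exists g.
  by move=> x y gxy; apply: h_inj; rewrite !hE gxy.
by move=> x y; rewrite -i_mono -!hE h_mono.
Qed.

Lemma embeds_induced (G : sgraph) (S : {set G}) : embeds (induced S) G.
Proof. by exists val => //; apply: val_inj. Qed.

Lemma free_ofP (F G : sgraph) : free_of F G <-> ~ embeds F G.
Proof.
split=> [freeG [h h_inj h_mono] | nemb S [h [g hK gK] h_mono]].
  have hS x : h x \in [set h x | x in F] by apply: imset_f.
  pose g x : induced [set h x | x in F] := Sub (h x) (hS x).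
  have g_inj : injective g by move=> x y /(congr1 val); apply: h_inj.
  have [g' gK g'K] : bijective g.
    by apply: inj_card_bij => //; rewrite /= card_sig card_imset.
  apply: (freeG [set h x | x in F]); exists g'; first by exists g.
  by move=> x y; rewrite -[x in RHS]g'K -[y in RHS]g'K /= /induced_adj h_mono.
apply: nemb; apply: embeds_trans (embeds_induced S); exists g.
  exact: can_inj gK.
by move=> x y; rewrite -h_mono !gK.
Qed.

Lemma free_of_embeds (F G K : sgraph) : embeds G K -> free_of F K -> free_of F G.
Proof.
by move=> GK /free_ofP FK; apply/free_ofP => FG; apply/FK/(embeds_trans FG).
Qed.

Definition nbh (G : sgraph) (v : G) : {set G} := [set x | adj v x].

(** A copy of F inside N(v) forms K_1 + F together with v. *)
Lemma free_of_nbh (F G : sgraph) (v : G) :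
  free_of (join_graph (complete_graph 1) F) G -> free_of F (induced (nbh v)).
Proof.
move=> /free_ofP freeG; apply/free_ofP => -[h h_inj h_mono]; apply: freeG.
have v_h x : adj v (val (h x)) by have := valP (h x); rewrite inE.
exists (fun u => match u with inl _ => v | inr x => val (h x) end).
  move=> [i|x] [j|y] //=.
  - by rewrite (ord1 i) (ord1 j).
  - by move=> vE; have := v_h y; rewrite /= -vE adj_irrefl.
  - by move=> vE; have := v_h x; rewrite /= vE adj_irrefl.
  by move=> /val_inj /h_inj->.
move=> [i|x] [j|y] /=; rewrite ?v_h ?adj_irrefl //.
- by rewrite (ord1 i) (ord1 j) /complete_adj eqxx.
- by rewrite adj_sym v_h.
exact: h_mono.
Qed.

(** Injectivity comes for free: distinct vertices of P_5 have distinct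
neighbourhoods, so a map preserving adjacency both ways cannot identify them. *)
Lemma embeds_P5 (G : sgraph) (a b c d e : G) :
  adj a b -> adj b c -> adj c d -> adj d e ->
  ~~ adj a c -> ~~ adj a d -> ~~ adj a e ->
  ~~ adj b d -> ~~ adj b e -> ~~ adj c e ->
  embeds (path_graph 5) G.
Proof.
move=> ab bc cd de /negPf ac /negPf ad /negPf ae /negPf bd /negPf be /negPf ce.
pose h (i : path_graph 5) := nth a [:: a; b; c; d; e] (i : 'I_5).
have h_mono : {mono h : x y / adj x y}.
  move=> [[|[|[|[|[|i]]]]] //= Hi] [[|[|[|[|[|j]]]]] //= Hj];
  by rewrite /h /= /path_adj /= ?adj_irrefl // 1?adj_sym ?ab ?bc ?cd ?de
     ?ac ?ad ?ae ?bd ?be ?ce // 1?adj_sym ?ab ?bc ?cd ?de ?ac ?ad ?ae ?bd ?be ?ce.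
exists h => // i j hij.
have twin k : adj i k = adj j k by rewrite -!h_mono hij.
(* The columns of 0, 1 and 3 already separate the five rows of the adjacency
   matrix. *)
apply/val_inj; have := (twin (inord 0), twin (inord 1), twin (inord 3)).
rewrite /= /path_adj !inordK //.
by case: i j {hij twin} => [[|[|[|[|[|i]]]]] //= Hi] [[|[|[|[|[|j]]]]] //= Hj] [[]].
Qed.

(** * Colourings of vertex subsets *)

(** Colours are natural numbers, and the colouring is a function on all of G, so
that colourings of different vertex sets can be glued without coercions. *)
Definition colorable_in (G : sgraph) (A : {set G}) (k : nat) : Prop :=
  exists c : G -> nat, {in A, forall x, c x < k} /\
    {in A &, forall x y, adj x y -> c x != c y}.

Lemma colorable_inT (G : sgraph) k : colorable G k <-> colorable_in [set: G] k.
Proof.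
split=> [/existsP[c /forallP c_ok] | [c [c_lt c_ok]]].
  exists (fun x => val (c x)); split=> [x _|x y _ _]; first exact: ltn_ord.
  by apply/implyP; have /forallP/(_ y) := c_ok x.
apply/existsP; exists [ffun x => Ordinal (c_lt x (in_setT x))].
apply/forallP=> x; apply/forallP=> y; apply/implyP=> xy; rewrite !ffunE.
by apply: c_ok; rewrite ?inE.
Qed.

Lemma chi_leP (G : sgraph) k : reflect (colorable_in [set: G] k) (chi G <= k).
Proof.
apply: (iffP idP) => [|col]; rewrite /chi; case: ex_minnP => m.
  move=> /colorable_inT[c [c_lt c_ok]] _ le_mk.
  by exists c; split=> // x /c_lt /leq_trans; apply.
by move=> _; apply; apply/colorable_inT.
Qed.

Lemma chi_embeds (F G : sgraph) : embeds F G -> chi F <= chi G.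
Proof.
move=> [h _ h_mono]; apply/chi_leP; have /chi_leP[c [c_lt c_ok]] := leqnn (chi G).
exists (c \o h); split=> [x _|x y _ _ xy]; first by apply: c_lt; rewrite inE.
by apply: c_ok; rewrite ?inE ?h_mono.
Qed.

Lemma chi_gt0 (G : sgraph) : 0 < #|G| -> 0 < chi G.
Proof.
case/card_gt0P=> x _; rewrite lt0n; apply/negP=> /eqP chi0.
have /chi_leP[c [/(_ x)]] : chi G <= 0 by rewrite chi0.
by rewrite inE => /(_ isT).
Qed.

Lemma colorable_in_induced (G : sgraph) (S : {set G}) k :
  chi (induced S) <= k -> colorable_in S k.
Proof.
move=> /chi_leP[c [c_lt c_ok]].
exists (fun x => if insub x is Some u then c u else 0); split.
  by move=> x xS; rewrite insubT; apply: c_lt; rewrite inE.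
by move=> x y xS yS xy; rewrite !insubT; apply: c_ok; rewrite ?inE.
Qed.

Lemma colorable_in1 (G : sgraph) (v : G) : colorable_in [set v] 1.
Proof.
exists (fun=> 0); split=> // x y /set1P-> /set1P->.
by rewrite adj_irrefl.
Qed.

Lemma colorable_inS (G : sgraph) (A B : {set G}) k :
  A \subset B -> colorable_in B k -> colorable_in A k.
Proof.
move=> /subsetP sAB [c [c_lt c_ok]]; exists c.
by split=> [x /sAB /c_lt|x y /sAB xB /sAB]; last apply: c_ok.
Qed.

(** The two sets get disjoint palettes: the colours of B are shifted by k. *)
Lemma colorable_inU (G : sgraph) (A B : {set G}) k l :
  colorable_in A k -> colorable_in B l -> colorable_in (A :|: B) (k + l).
Proof.
move=> [c [c_lt c_ok]] [d [d_lt d_ok]].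
exists (fun x => if x \in A then c x else k + d x); split.
  move=> x /setUP[]; case: ifP => // xA xB.
  - by rewrite (leq_trans (c_lt x xA)) ?leq_addr.
  - by rewrite (leq_trans (c_lt x xA)) ?leq_addr.
  by rewrite ltn_add2l d_lt.
move=> x y; rewrite !inE; case: ifP => xA xB; case: ifP => yA yB xy.
- exact: c_ok.
- by rewrite neq_ltn (leq_trans (c_lt x xA)) ?leq_addr.
- by rewrite neq_ltn (leq_trans (c_lt y yA)) ?leq_addr ?orbT.
by rewrite eqn_add2l d_ok.
Qed.

(** * Components *)

Definition adj_in (G : sgraph) (A : {set G}) : rel G :=
  fun x y => [&& x \in A, y \in A & adj x y].

Definition component (G : sgraph) (A : {set G}) (x : G) : {set G} :=
  [set y | connect (adj_in A) x y].

Lemma adj_in_connect_sym (G : sgraph) (A : {set G}) : connect_sym (adj_in A).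
Proof. by apply: sym_connect_sym => x y; rewrite /adj_in adj_sym andbCA. Qed.

Lemma component_sub (G : sgraph) (A : {set G}) x :
  x \in A -> component A x \subset A.
Proof.
move=> xA; apply/subsetP=> y; rewrite inE => /connectP[p].
by case/lastP: p => [_ -> //|p z]; rewrite rcons_path last_rcons => /and4P[_ _ ? _] ->.
Qed.

Lemma component_refl (G : sgraph) (A : {set G}) x : x \in component A x.
Proof. by rewrite inE connect0. Qed.

Lemma component_adj (G : sgraph) (A : {set G}) x y z :
  x \in A -> y \in component A x -> z \in A -> adj y z -> z \in component A x.
Proof.
move=> xA yC zA yz; have yA := subsetP (component_sub xA) y yC.
rewrite !inE in yC *; apply: connect_trans yC (connect1 _).
by rewrite /adj_in yA zA.
Qed.

(** Distinct components of A have no edge between them, so they can share one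
palette; each vertex is coloured by the colouring chosen for the canonical root
of its component. *)
Lemma colorable_in_components (G : sgraph) (A : {set G}) k :
  {in A, forall x, colorable_in (component A x) k} -> colorable_in A k.
Proof.
move=> colC; have cS := adj_in_connect_sym A.
have /fin_all_exists[c c_ok] : forall x : G, exists c : G -> nat, x \in A ->
    {in component A x, forall y, c y < k} /\
    {in component A x &, forall y z, adj y z -> c y != c z}.
  move=> x; case: (boolP (x \in A)) => [/colC[c ?]|_]; first by exists c.
  by exists (fun=> 0).
pose r x := fingraph.root (adj_in A) x.
have rC x : x \in component A (r x).
  by rewrite inE cS connect_root.
have rA x : x \in A -> r x \in A.
  move=> xA; have /subsetP := component_sub xA; apply.
  by rewrite inE connect_root.
exists (fun x => c (r x) x); split=> [x xA|x y xA yA xy].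
  by have [c_lt _] := c_ok _ (rA x xA); apply: c_lt.
have -> : r y = r x.
  by apply/esym/(fingraph.rootP cS)/connect1; rewrite /adj_in xA yA.
have [_] := c_ok _ (rA x xA); apply=> //.
exact: component_adj (rA x xA) (rC x) yA xy.
Qed.

(** A path leaving B crosses its boundary. This single fact provides the vertex
attaching a component to the rest of the graph as well as the edge on which
adjacency to a given vertex changes. *)
Lemma connect_exit (T : finType) (e : rel T) (B : {set T}) x y :
  connect e x y -> x \in B -> y \notin B ->
  exists u w, [/\ u \in B, w \notin B & e u w].
Proof.
case/connectP=> p; elim: p x => [x _ -> ->|z p IHp x /= /andP[xz zp] y_last xB yB] //.
have [zB|zB] := boolP (z \in B); first exact: IHp zp y_last zB yB.
by exists x, z.
Qed.

(** Otherwise an edge p q of the component has p adjacent to a and q not, and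
v - x - a - p - q is an induced P_5. *)
Lemma component_sub_nbh (G : sgraph) (A : {set G}) (v x a b : G) :
  free_of (path_graph 5) G ->
  adj v x -> adj x a -> ~~ adj v a ->
  {in A, forall y, ~~ adj v y /\ ~~ adj x y} ->
  b \in A -> adj a b -> component A b \subset nbh a.
Proof.
move=> /free_ofP P5G vx xa va vxA bA ab; apply/subsetP=> y bCy.
apply: contra_notT P5G => ay; rewrite inE in bCy.
have [||p [q []]] := connect_exit (B := nbh a) bCy => //; first by rewrite inE.
rewrite !inE => ap aq /and3P[/vxA[vp xp] /vxA[vq xq] pq].
exact: embeds_P5 vx xa ap pq va vp vq xp xq aq.
Qed.

(** The summand 1 pays for the start v of the path, and the three palettes of
size c for N(v), for the part of each component A lying in N(x), and for the
rest of A, each component of which lies in some neighbourhood N(a). *)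
Lemma chi_gyarfas (G : sgraph) c :
  connected G -> free_of (path_graph 5) G ->
  (forall v : G, colorable_in (nbh v) c) -> chi G <= 3 * c + 1.
Proof.
move=> [/card_gt0P[v _] conG] P5G colN; apply/chi_leP.
pose W := ~: (v |: nbh v).
have vW y : y \in W -> ~~ adj v y by rewrite !inE negb_or => /andP[].
suff colW : colorable_in W (c + c).
  apply: (@colorable_inS _ _ (W :|: nbh v :|: [set v])).
    by apply/subsetP=> y _; rewrite !inE; case: (y == v); case: adj.
  have -> : 3 * c + 1 = c + c + c + 1 by rewrite !mulSn mul0n addn0 addnA.
  exact: colorable_inU (colorable_inU colW (colN v)) (colorable_in1 v).
apply: colorable_in_components => z zW; set A := component W z.
have sAW : A \subset W := component_sub zW.
have zA : z \in A := component_refl W z.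
have vA : v \notin A by apply/negP=> /(subsetP sAW); rewrite !inE eqxx.
(* The edge u x leaving A must end in N(v), since A absorbs every neighbour
   outside v and N(v). *)
have [u [x [uA xA ux]]] := connect_exit (conG z v) zA vA.
have vx : adj v x.
  have: x \notin W by apply: contra xA => xW; apply: component_adj zW uA xW ux.
  rewrite !inE negbK => /predU1P[xv|//].
  by have := vW u (subsetP sAW u uA); rewrite adj_sym -xv ux.
have xu : adj x u by rewrite adj_sym.
apply: (@colorable_inS _ _ (nbh x :|: (A :\: nbh x))).
  by apply/subsetP=> y yA; rewrite in_setU in_setD yA andbT orbN.
apply: colorable_inU (colN x) _.
apply: colorable_in_components => y yAx; set B := component _ y.
have sBA : B \subset A :\: nbh x := component_sub yAx.
have yA : y \in A by case/setDP: yAx.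
have uB : u \notin B by apply/negP=> /(subsetP sBA); rewrite !inE xu.
have yu : connect (adj_in W) y u.
  move: yA uA; rewrite !inE (adj_in_connect_sym W z) => yz zu.
  exact: connect_trans yz zu.
(* A is connected but B is not all of it, since u lies in N(x): an edge b a of
   A leaves B, and it must end in N(x). *)
have [b [a [bB aB /and3P[bW aW ba]]]] := connect_exit yu (component_refl _ y) uB.
have aA : a \in A.
  by have /setDP[bA _] := subsetP sBA b bB; apply: component_adj zW bA aW ba.
have xa : adj x a.
  apply: contraNT aB => xa; apply: component_adj yAx bB _ ba.
  by rewrite in_setD aA inE xa.
have bAx := subsetP sBA b bB.
have B_b : B = component (A :\: nbh x) b.
  apply/setP=> w; rewrite !inE; apply: same_connect => //.
    exact: adj_in_connect_sym.
  by rewrite inE in bB.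
apply: colorable_inS (colN a); rewrite B_b.
apply: (@component_sub_nbh _ _ v x) => //; last by rewrite adj_sym.
  exact: vW.
move=> w /setDP[wA]; rewrite inE => xw; split=> //.
exact: vW (subsetP sAW w wA).
Qed.

(** * Clique numbers *)

Lemma cliqueP (G : sgraph) (S : {set G}) :
  reflect {in S &, forall x y, x != y -> adj x y} (clique S).
Proof.
apply: (iffP forall_inP) => [cl x y xS yS|cl x xS].
  by have /forall_inP/(_ y yS)/implyP := cl x xS.
by apply/forall_inP=> y yS; apply/implyP; apply: cl.
Qed.

Lemma leq_omega (G : sgraph) (S : {set G}) : clique S -> #|S| <= omega G.
Proof. by move=> clS; rewrite /omega; apply: (leq_bigmax_cond (P := @clique G)). Qed.

Lemma omega_leq (G : sgraph) k :
  (forall S : {set G}, clique S -> #|S| <= k) -> omega G <= k.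
Proof. by move=> le_k; apply/bigmax_leqP. Qed.

Lemma max_clique (G : sgraph) : exists2 S : {set G}, clique S & #|S| = omega G.
Proof.
have cl0 : clique (set0 : {set G}) by apply/cliqueP=> x; rewrite inE.
have [|S clS S_max] := @eq_bigmax_cond _ (@clique G) (fun S => #|S|).
  by apply/card_gt0P; exists set0.
by exists S => //; rewrite -S_max.
Qed.

Lemma clique_preim (F G : sgraph) (h : F -> G) (S : {set G}) :
  injective h -> {mono h : x y / adj x y} -> clique S -> clique (h @^-1: S).
Proof.
move=> h_inj h_mono /cliqueP clS; apply/cliqueP=> x y; rewrite !inE => xS yS xy.
by rewrite -h_mono clS // inj_eq.
Qed.

Lemma clique_im (F G : sgraph) (h : F -> G) (S : {set F}) :
  {mono h : x y / adj x y} -> clique S -> clique (h @: S).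
Proof.
move=> h_mono /cliqueP clS; apply/cliqueP=> _ _ /imsetP[x xS ->] /imsetP[y yS ->].
by move=> hxy; rewrite h_mono clS //; apply: contraNneq hxy => ->.
Qed.

Lemma omega_embeds (F G : sgraph) : embeds F G -> omega F <= omega G.
Proof.
move=> [h h_inj h_mono]; apply: omega_leq => S clS.
by rewrite -(card_imset (mem S) h_inj) leq_omega ?clique_im.
Qed.

(** Adding v to a clique of N(v) gives a clique of G. *)
Lemma omega_nbh (G : sgraph) (v : G) : omega (induced (nbh v)) <= omega G - 1.
Proof.
have [S clS <-] := max_clique (induced (nbh v)).
have clS' : clique (val @: S) by apply: clique_im clS.
have vS x : x \in val @: S -> adj v x.
  by case/imsetP=> u _ ->; have := valP u; rewrite inE.
rewrite -(card_imset (mem S) val_inj) -ltnS subn1.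
suff lt_S : #|val @: S| < omega G by rewrite prednK // (leq_ltn_trans _ lt_S).
have vnS : v \notin val @: S by apply/negP=> /vS; rewrite adj_irrefl.
have <- : #|v |: val @: S| = #|val @: S|.+1 by rewrite cardsU1 vnS.
apply: leq_omega; move/cliqueP: clS' => clS'; apply/cliqueP=> x y /setU1P[->|xS] /setU1P[->|yS].
- by rewrite eqxx.
- by move=> _; apply: vS.
- by move=> _; rewrite adj_sym vS.
exact: clS'.
Qed.

(** Any vertex of a maximum clique attains the bound. *)
Lemma omega_nbh_eq (G : sgraph) :
  0 < #|G| -> exists v : G, omega (induced (nbh v)) = omega G - 1.
Proof.
move=> /card_gt0P[v0 _]; have [S clS S_omega] := max_clique G.
have: 0 < #|S|.
  rewrite S_omega -[1](cards1 v0) leq_omega //.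
  by apply/cliqueP=> x y /set1P-> /set1P->; rewrite eqxx.
case/card_gt0P=> v vS; exists v; apply/eqP; rewrite eqn_leq omega_nbh /=.
have sSN : S :\ v \subset nbh v.
  apply/subsetP=> x /setD1P[xv xS]; rewrite inE.
  by move/cliqueP: clS; apply=> //; rewrite eq_sym.
pose S' : {set induced (nbh v)} := val @^-1: (S :\ v).
have -> : omega G - 1 = #|S'|.
  rewrite -S_omega (cardsD1 v S) vS addKn -(card_imset (mem S') val_inj).
  congr #|pred_of_set _|; apply/setP=> x; apply/idP/imsetP=> [xS|[u uS ->]].
    by exists (Sub x (subsetP sSN x xS)); rewrite ?inE SubK // -in_setD1.
  by rewrite inE in uS.
apply: leq_omega; apply: (@clique_preim (induced _) G val) => //; first exact: val_inj.
apply/cliqueP=> x y.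
by move=> /setD1P[_ xS] /setD1P[_ yS]; move/cliqueP: clS; apply.
Qed.

Lemma card_sum_set (A B : finType) (S : {set A + B}) :
  #|S| = #|inl @^-1: S| + #|inr @^-1: S|.
Proof.
rewrite -!sum1_card big_sumType.
by congr (_ + _); apply: eq_bigl => x; rewrite inE.
Qed.

Lemma omega_union (G1 G2 : sgraph) :
  omega G1 <= omega G2 -> omega (union_graph G1 G2) = omega G2.
Proof.
move=> le12; apply/eqP; rewrite eqn_leq; apply/andP; split; last first.
  by apply: omega_embeds; exists inr => // x y [].
apply: omega_leq => S clS; rewrite card_sum_set.
have cl1 : clique ((inl : G1 -> union_graph G1 G2) @^-1: S).
  by apply: clique_preim clS => // x y [].
have cl2 : clique ((inr : G2 -> union_graph G1 G2) @^-1: S).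
  by apply: clique_preim clS => // x y [].
have [->|[x]] := set_0Vmem ((inl : G1 -> union_graph G1 G2) @^-1: S).
  by rewrite cards0 leq_omega.
have [->|[y]] := set_0Vmem ((inr : G2 -> union_graph G1 G2) @^-1: S).
  by rewrite cards0 addn0 (leq_trans (leq_omega cl1)).
by rewrite !inE => yS xS; have /cliqueP/(_ _ _ xS yS isT) := clS.
Qed.

Lemma omega_join_complete (G : sgraph) j :
  omega (join_graph G (complete_graph j)) = omega G + j.
Proof.
set J := join_graph _ _; apply/eqP; rewrite eqn_leq; apply/andP; split.
  apply: omega_leq => S clS; rewrite card_sum_set leq_add //.
    by apply: leq_omega; apply: (clique_preim (G := J)) clS => // x y [].
  by rewrite -[leqRHS]card_ord max_card.
have [S /cliqueP clS <-] := max_clique G.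
pose T : {set J} := [set u | if u is inl x then x \in S else true].
have -> : #|S| + j = #|T|.
  rewrite card_sum_set; congr (_ + _); first by apply: eq_card => x; rewrite !inE.
  by rewrite -[LHS]card_ord; apply/esym/eq_card => x; rewrite !inE.
apply: leq_omega; apply/cliqueP=> -[x|x] [y|y]; rewrite !inE //= => xS yS.
by apply: clS.
Qed.

(** * Enlarging a free graph *)

(** A connected F cannot be spread over both sides of a disjoint union. *)
Lemma free_of_union (F G1 G2 : sgraph) :
  connected F -> free_of F G1 -> free_of F G2 -> free_of F (union_graph G1 G2).
Proof.
move=> [/card_gt0P[x0 _] conF] /free_ofP F1 /free_ofP F2.
apply/free_ofP=> -[h h_inj h_mono].
pose isl (u : union_graph G1 G2) := if u is inl _ then true else false.
have hl x : isl (h x) = isl (h x0).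
  apply/esym; have /closed_connect : closed adj [pred x | isl (h x)].
    by move=> y z; rewrite -h_mono /= !inE; case: (h y) (h z) => ? [].
  by move/(_ _ _ (conF x0 x)).
case: (h x0) hl => a hl;
  [ apply: F1; pose i (x : G1) : union_graph G1 G2 := inl x
  | apply: F2; pose i (x : G2) : union_graph G1 G2 := inr x ];
  apply: (embeds_factor (i := i) h_inj h_mono) => // x;
  by have := hl x; case: (h x) => // b _; exists b.
Qed.

(** A vertex of the complete side is adjacent to everything else, so a copy of F
using it would have a vertex adjacent to all its others. *)
Lemma free_of_join_complete (F G : sgraph) j :
  (forall x : F, exists2 y, x != y & ~~ adj x y) ->
  free_of F G -> free_of F (join_graph G (complete_graph j)).
Proof.
move=> nuniv /free_ofP FG; apply/free_ofP=> -[h h_inj h_mono]; apply: FG.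
pose i (x : G) : join_graph G (complete_graph j) := inl x.
apply: (embeds_factor (i := i) h_inj h_mono) => // x.
case hx: (h x) => [b|b]; first by exists b.
have [y xy] := nuniv x; rewrite -h_mono hx.
case hy: (h y) => [//|d] /=; rewrite /complete_adj negbK => /eqP bd.
by case/eqP: xy; apply: h_inj; rewrite hx hy bd.
Qed.

Lemma connected_P5 : connected (path_graph 5).
Proof.
split; first by rewrite card_ord.
have c0 (x : path_graph 5) : connect adj (ord0 : path_graph 5) x.
  case: x => m; elim: m => [|m IHm] lt_m.
    by rewrite (_ : Ordinal _ = ord0) ?connect0 //; apply: val_inj.
  apply: connect_trans (IHm (ltnW lt_m)) (connect1 _).
  by rewrite /= /path_adj /= eqxx.
move=> x y; apply: connect_trans (c0 y).
by rewrite (sym_connect_sym (@adj_sym _)).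
Qed.

Lemma P5_nonuniversal (x : path_graph 5) : exists2 y, x != y & ~~ adj x y.
Proof.
exists (if val x <= 1 then inord 4 else inord 0);
by case: x => [[|[|[|[|[|x]]]]] lt_x] //=; rewrite -?val_eqE /= /path_adj /= ?inordK.
Qed.

(** The isolated vertex and the nonempty connected part miss each other. *)
Lemma isolated_nonuniversal (H H' : sgraph) :
  connected H' -> isomorphic H (union_graph H' (complete_graph 1)) ->
  forall x : H, exists2 y, x != y & ~~ adj x y.
Proof.
move=> [/card_gt0P[a _] _] [h [g hK gK] h_mono] x.
case hx: (h x) => [b|b].
  exists (g (inr ord0)); last by rewrite -h_mono gK hx.
  by apply/eqP=> xE; rewrite xE gK in hx.
exists (g (inl a)); last by rewrite -h_mono gK hx.
by apply/eqP=> xE; rewrite xE gK in hx.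
Qed.

(** * The bound *)

Local Open Scope ring_scope.

(** The clique number of N(v) may be smaller than omega(G) - 1 and f may
decrease, so the hypothesis on f is applied to a graph K containing N(v) whose
clique number is the right one. *)
Lemma chi_binding_nbh (R : realFieldType) (H G : sgraph) (f : nat -> R) (v : G) :
  connected H \/
    (exists H' : sgraph,
       connected H' /\ isomorphic H (union_graph H' (complete_graph 1))) ->
  free_of2 (path_graph 5) (join_graph (complete_graph 1) H) G ->
  chi_binding (free_of2 (path_graph 5) H) f ->
  (chi (induced (nbh v)))%:R <= f (omega G - 1)%N.
Proof.
move=> caseH [P5G HG] bind.
have P5N (w : G) : free_of (path_graph 5) (induced (nbh w)).
  exact: free_of_embeds (embeds_induced _) P5G.
have HN (w : G) : free_of H (induced (nbh w)) by apply: free_of_nbh.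
have le_omega := omega_nbh v.
suff [K [vK freeK <-]] : exists K, [/\ embeds (induced (nbh v)) K,
    free_of2 (path_graph 5) H K & omega K = (omega G - 1)%N].
  by apply: le_trans (bind K freeK); rewrite ler_nat chi_embeds.
case: caseH => [conH | [H' [conH' isoH]]].
  have [|w w_omega] := @omega_nbh_eq G; first by apply/card_gt0P; exists v.
  exists (union_graph (induced (nbh v)) (induced (nbh w))); split.
  - by exists inl => // x y [].
  - by split; apply: free_of_union => //; apply: connected_P5.
  by rewrite omega_union w_omega.
exists (join_graph (induced (nbh v))
          (complete_graph (omega G - 1 - omega (induced (nbh v))))); split.
- by exists inl => // x y [].
- split; apply: free_of_join_complete => //; first exact: P5_nonuniversal.
  exact: isolated_nonuniversal conH' isoH.
by rewrite omega_join_complete subnKC.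
Qed.

Theorem theorem1p1 (R : realFieldType) (H G : sgraph) (f : nat -> R) :
  connected H \/
    (exists H' : sgraph,
       connected H' /\ isomorphic H (union_graph H' (complete_graph 1))) ->
  (3 <= #|H|)%N ->
  connected G ->
  free_of2 (path_graph 5) (join_graph (complete_graph 1) H) G ->
  chi_binding (free_of2 (path_graph 5) H) f ->
  (chi G)%:R <= Num.max (chi H)%:R (f (omega G - 1)%N)
                + #|H|%:R * f (omega G - 1)%N
  /\ ((chi H)%:R <= f (omega G - 1)%N ->
      (chi G)%:R <= (#|H| + 1)%:R * f (omega G - 1)%N).
Proof.
move=> caseH cardH conG freeG bind; set k := (omega G - 1)%N.
suff main : (chi G)%:R <= Num.max (chi H)%:R (f k) + #|H|%:R * f k.
  split=> // chiH; apply: le_trans main _.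
  by rewrite (max_idPr chiH) natrD mulrDl mul1r addrC.
have [v0 _] : exists v : G, v \in G by apply/card_gt0P; case: conG.
pose v := [arg max_(u > v0) chi (induced (nbh u))]%N.
have vmax (u : G) : (chi (induced (nbh u)) <= chi (induced (nbh v)))%N.
  by rewrite /v; case: arg_maxnP => // w _; apply.
have cf : (chi (induced (nbh v)))%:R <= f k := chi_binding_nbh v caseH freeG bind.
have colN (u : G) : colorable_in (nbh u) (chi (induced (nbh v))).
  exact: colorable_in_induced (vmax u).
(* In 3 c + 1, the 1 is absorbed by chi(H) and the factor 3 by |H|. *)
have := chi_gyarfas conG freeG.1 colN.
rewrite -(ler_nat R) => /le_trans; apply; rewrite natrD natrM addrC lerD //.
  by rewrite le_max ler1n chi_gt0 // (leq_trans _ cardH).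
by rewrite ler_pM ?ler0n ?ler_nat.
Qed.
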